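(* Let $n,k$ be integers with $3\le k\le n-1$, $n>2k$ and $n$ odd. Then the number $w_{n,k}$ of vertices of $G(n)$ contained in some closed $k$-walk satisfies \[w_{n,k}\le \frac{(n-2)!}{(n-k)!}\left(\left(n+\frac12\right)(n+1)(n-1)+k+\frac{n-5}{2}-2-(n-1)\left\lceil\frac{n-1}{4}\right\rceil\right).\]
   Context: For a sequence of distinct integers $c_1\cdots c_t$, $\mathrm{st}(c_1\cdots c_t)$ is the unique permutation $d_1\cdots d_t$ of $\{1,\dots,t\}$ with $d_i<d_j$ iff $c_i<c_j$. $G(n)$ is the directed multigraph whose vertices are the permutations of $\{1,\dots,n\}$ (one-line notation) and whose edges are the permutations $c_1\cdots c_{n+1}$ of $\{1,\dots,n+1\}$, the edge $c_1\cdots c_{n+1}$ going from $\mathrm{st}(c_1\cdots c_n)$ to $\mathrm{st}(c_2\cdots c_{n+1})$; so there is an edge from $x_1\cdots x_n$ to $w_1\cdots w_n$ iff $\mathrm{st}(x_2\cdots x_n)=\mathrm{st}(w_1\cdots w_{n-1})$. A closed $k$-walk $(v_1,\dots,v_k)$ is a sequence of vertices with an edge from $v_i$ to $v_{i+1}$ for $i<k$ and from $v_k$ to $v_1$. *)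

(* Defs.v *)
From mathcomp Require Import all_boot all_order all_fingroup all_algebra.

Set Implicit Arguments.
Unset Strict Implicit.
Unset Printing Implicit Defensive.

Import Order.TTheory GRing.Theory Num.Theory.

Local Open Scope ring_scope.

(* Permutations are 0-based: d : 'S_t has one-line notation
   (d 0 + 1) ... (d (t-1) + 1).  The shift does not affect order comparisons. *)

Definition same_order (t : nat) (c : 'I_t -> int) (d : 'S_t) : bool :=
  [forall i, forall j, (d i < d j)%N == (c i < c j)].

(* The default value 1 is only taken when c has repeated entries (see stP). *)
Definition st (t : nat) (c : 'I_t -> int) : 'S_t :=
  odflt 1%g [pick d | same_order c d].

Lemma same_order_uniq (t : nat) (c : 'I_t -> int) (d e : 'S_t) :
  same_order c d -> same_order c e -> d = e.
Proof.
have rank (f : 'S_t) i : #|[set j | (f j < f i)%N]| = f i :> nat.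
  transitivity #|[set j : 'I_t | (j < f i)%N]|.
    rewrite -(card_imset _ (@perm_inj _ f)); apply: eq_card => y.
    rewrite inE; apply/imsetP/idP => [[x + ->]|lt_y]; first by rewrite inE.
    by exists (f^-1 y)%g; rewrite ?inE permKV.
  rewrite cardsE -sum1_card big_mkcond /=.
  rewrite -(big_mkord xpredT (fun j => if (j < f i)%N then 1%N else 0%N)).
  rewrite -big_mkcond /= -(big_nat_widen 0 (f i) t xpredT) 1?ltnW //.
  by rewrite sum_nat_const_nat subn0 muln1.
move=> /forallP dP /forallP eP; apply/permP => i; apply: val_inj => /=.
rewrite -(rank d) -(rank e); apply: eq_card => j; rewrite !inE.
by have /forallP/(_ i)/eqP-> := dP j; have /forallP/(_ i)/eqP-> := eP j.
Qed.

Lemma stP (t : nat) (c : 'I_t -> int) : injective c -> same_order c (st c).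
Proof.
move=> c_inj; rewrite /st; case: pickP => //= no_d.
pose A i := [set j | c j < c i].
have ltA i : (#|A i| < t)%N.
  rewrite -[X in (_ < X)%N]card_ord -cardsT; apply/proper_card/properP.
  by split; [exact: subsetT | exists i; rewrite ?inE // ltxx].
have rk_mono i j : (#|A i| < #|A j|)%N = (c i < c j).
  case: (ltP (c i) (c j)) => [lt_ij | le_ji].
    apply/proper_card/properP; split; last by exists i; rewrite !inE ?ltxx.
    by apply/subsetP => l; rewrite !inE => /lt_trans; apply.
  apply/negbTE; rewrite -leqNgt; apply/subset_leq_card/subsetP => l.
  by rewrite !inE => /lt_le_trans; apply.
have r_inj : injective (fun i => Ordinal (ltA i)).
  move=> i j /(congr1 val) /= eq_rk; apply: c_inj; apply/eqP.
  by rewrite eq_le !leNgt -!rk_mono eq_rk ltnn.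
have /negP[] := no_d (perm r_inj).
by apply/forallP => i; apply/forallP => j; rewrite !permE /= rk_mono.
Qed.

(* In the graph of overlapping permutations G(n), an edge is any c : 'S_n.+1,
   going from st(c_1 ... c_n) to st(c_2 ... c_{n+1}); lift ord_max keeps the
   index and lift ord0 increments it. *)
Definition edge_source (n : nat) (c : 'S_n.+1) : 'S_n :=
  st (fun i : 'I_n => (c (lift ord_max i))%:Z).

Definition edge_target (n : nat) (c : 'S_n.+1) : 'S_n :=
  st (fun i : 'I_n => (c (lift ord0 i))%:Z).

Definition has_edge (n : nat) : rel 'S_n :=
  fun x w => [exists c : 'S_n.+1, (edge_source c == x) && (edge_target c == w)].

(* [path.cycle e p] asks for e between consecutive entries of p and from
   the last entry to the first; entries may repeat. *)
Definition closed_walk (n k : nat) (p : k.-tuple 'S_n) : bool :=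
  path.cycle (@has_edge n) p.

Definition num_closed_walk_vertices (n k : nat) : nat :=
  #|[set v : 'S_n | [exists p : k.-tuple 'S_n, closed_walk p && (v \in p)]]|.

(* Main.v *)
(** A vertex [v] of a closed [k]-walk satisfies [v (i + k) < v (j + k)] iff
    [v i < v j], so [v] is monotone on each residue class of positions modulo
    [k].  Such a [v] is determined by its first [k] entries.  Indeed these
    entries tell which classes rise and which fall; a rising and a falling class
    never interleave, so they compare as their first entries do; and the order
    on the rising positions (dually, the falling ones) is rebuilt from its
    minimum upwards by shift invariance.  Hence there are at most
    [n! / (n - k)! = (n - 2)! / (n - k)! * n (n - 1)] such vertices, which is
    already below the stated bound. *)

Require Import Defs.
From mathcomp Require Import all_boot all_order all_fingroup all_algebra.
From mathcomp Require Import zify ring lra.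

Set Implicit Arguments.
Unset Strict Implicit.
Unset Printing Implicit Defensive.

Import Order.TTheory GRing.Theory Num.Theory.

(** * From closed walks to shift invariance *)

Definition shift_invariant (n k : nat) (v : 'I_n -> nat) : Prop :=
  forall i j i' j' : 'I_n, i' = i + k :> nat -> j' = j + k :> nat ->
    (v i' < v j') = (v i < v j).

(** Position [i.+1] of the source and position [i] of the target standardize the same entry of the
    edge [c]. *)
Lemma has_edge_lt (n : nat) (x w : 'S_n) (i j i' j' : 'I_n) :
  has_edge x w -> i' = i.+1 :> nat -> j' = j.+1 :> nat ->
  (x i' < x j') = (w i < w j).
Proof.
case/existsP => c /andP[/eqP <- /eqP <-] ei ej.
have intj_inj (h : 'I_n.+1) : injective (fun i : 'I_n => (c (lift h i))%:Z%R).
  by move=> a b [] /val_inj /perm_inj /lift_inj.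
have /forallP/(_ i')/forallP/(_ j')/eqP -> := stP (intj_inj ord_max).
have /forallP/(_ i)/forallP/(_ j)/eqP -> := stP (intj_inj ord0).
have lift_succ (a a' : 'I_n) : a' = a.+1 :> nat -> lift ord_max a' = lift ord0 a.
  by move=> e; apply: val_inj; rewrite /= /bump e; have := ltn_ord a'; lia.
by rewrite (lift_succ _ _ ei) (lift_succ _ _ ej).
Qed.

Lemma path_has_edge_lt (n : nat) (x : 'S_n) (p : seq 'S_n) (i j i' j' : 'I_n) :
  path (@has_edge n) x p -> i' = i + size p :> nat -> j' = j + size p :> nat ->
  (x i' < x j') = (last x p i < last x p j).
Proof.
elim: p x i' j' => [|y p IHp] x i' j' /=.
  by rewrite !addn0 => _ /val_inj-> /val_inj->.
case/andP => xy yp ei ej.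
have lti : i + size p < n by have := ltn_ord i'; lia.
have ltj : j + size p < n by have := ltn_ord j'; lia.
rewrite -(IHp y (Ordinal lti) (Ordinal ltj)) //.
by apply: has_edge_lt xy _ _ => /=; lia.
Qed.

(** Rotating the cycle so that it starts at [v] gives a path of [k] edges from [v] back to [v]; each
    edge shifts positions by one. *)
Lemma closed_walk_shift_invariant (n k : nat) (p : k.-tuple 'S_n) (v : 'S_n) :
  closed_walk p -> v \in p -> shift_invariant k (fun x => v x).
Proof.
rewrite /closed_walk => cp vp.
have [i q def_q] := rot_to vp.
have /= pq : path.cycle (@has_edge n) (v :: q) by rewrite -def_q rot_cycle.
have sz : size (rcons q v) = k.
  by rewrite size_rcons; have /(congr1 size) := def_q; rewrite size_rot size_tuple.
move=> a b a' b'; rewrite -sz => ea eb.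
by rewrite (path_has_edge_lt pq ea eb) last_rcons.
Qed.

Lemma card_perm_lt (n : nat) (v : 'S_n) (x : 'I_n) :
  #|[set y | v y < v x]| = v x.
Proof.
rewrite -[RHS]card_ord -(card_imset _ (@perm_inj _ v)) -[RHS]cardsT.
have lex : v x <= n by apply: ltnW.
have widen_inj : injective (widen_ord lex) by move=> a b [] /val_inj.
rewrite -(card_imset _ widen_inj).
apply: eq_card => z; apply/imsetP/imsetP => [[y + ->]|[y _ ->]].
  by rewrite inE => lt; exists (Ordinal lt) => //; apply: val_inj.
exists (v^-1 (widen_ord lex y))%g; last by rewrite permKV.
by rewrite inE permKV /=.
Qed.

Lemma perm_lt_inj (n : nat) (v w : 'S_n) :
  (forall x y, (v x < v y) = (w x < w y)) -> v = w.
Proof.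
move=> eq_lt; apply/permP => x; apply: val_inj => /=.
by rewrite -(card_perm_lt v) -(card_perm_lt w); apply: eq_card => y; rewrite !inE eq_lt.
Qed.

(** * Rebuilding a rising, shift-invariant order from the ranks of the heads *)

Section Rank.

Variables (n k : nat) (A : {set 'I_n}).
Hypothesis A_pred : forall x y : 'I_n, y = x + k :> nat -> y \in A -> x \in A.

Definition rank_in (v : 'I_n -> nat) (x : 'I_n) := #|[set z in A | v z < v x]|.

Lemma rank_in_lt (v : 'I_n -> nat) (x y : 'I_n) : x \in A ->
  (rank_in v x < rank_in v y) = (v x < v y).
Proof.
move=> xA; case: (ltnP (v x) (v y)) => [lt_xy | le_yx].
  apply/proper_card/properP; split.
    by apply/subsetP => z; rewrite !inE => /andP[-> /ltn_trans]; apply.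
  by exists x; rewrite !inE xA // ltnn.
apply/negbTE; rewrite -leqNgt; apply/subset_leq_card/subsetP => z.
by rewrite !inE => /andP[-> /leq_trans]; apply.
Qed.

(** Functions with values in [nat], not only permutations, are allowed so that the reversal
    [n - v x], which exchanges falling and rising, is covered too. *)
Definition increasing_shift (v : 'I_n -> nat) :=
  [/\ injective v,
      forall x y : 'I_n, y = x + k :> nat -> y \in A -> v x < v y &
      shift_invariant k v].

Definition same_head_rank (v w : 'I_n -> nat) :=
  forall r : 'I_n, r \in A -> r < k -> rank_in v r = rank_in w r.

(* The elements ranked below [m] agree for [v] and [w]; if the elements [j + k]
   and [i + k] of rank [m] differed, then [i], [j] would have rank below [m], and
   shift invariance would make [v] and [w] order them in opposite ways. *)
Lemma rank_in_unique (v w : 'I_n -> nat) :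
  increasing_shift v -> increasing_shift w -> same_head_rank v w ->
  {in A, rank_in v =1 rank_in w}.
Proof.
(* The bound concerns the rank under the first function only, so the induction carries both orders
   of the arguments at once. *)
pose agree m v w := forall x, x \in A -> rank_in v x < m ->
  rank_in v x = rank_in w x.
have predE (y : 'I_n) : k <= y -> {x : 'I_n | y = x + k :> nat}.
  move=> le_ky; have lt : y - k < n by have := ltn_ord y; lia.
  by exists (Ordinal lt); rewrite /= subnK.
have step m v' w' : increasing_shift v' -> increasing_shift w' ->
    same_head_rank v' w' -> agree m v' w' -> agree m w' v' -> agree m.+1 v' w'.
  move=> [v_inj v_inc v_sh] [w_inj w_inc w_sh] hd vw wv x xA.
  rewrite ltnS leq_eqVlt => /orP[/eqP rk_x|]; last exact: vw.
  case: (ltnP x k) => [|le_kx]; first exact: hd.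
  have [j xj] := predE x le_kx; have jA := A_pred xj xA.
  (* The [w']-least element [y] of [U] turns out to have [w']-rank [m]: below it under [w'] lie
     exactly the elements of [v']-rank less than [m]. *)
  pose U := [pred y in A | m <= rank_in v' y].
  have Ux : U x by rewrite inE xA rk_x /=.
  case: (arg_minnP w' Ux) => y /andP[yA /= le_my] y_min.
  have wU z : z \in A -> (w' z < w' y) = (v' z < v' x).
    move=> zA; rewrite -(rank_in_lt v' x zA) rk_x.
    case: (ltnP (rank_in v' z) m) => [lt_zm | le_mz]; last first.
      by apply/negbTE; rewrite -leqNgt; apply: y_min; rewrite /U /= zA.
    rewrite -(rank_in_lt w' y zA) -(vw _ zA lt_zm); apply: (leq_trans lt_zm).
    by rewrite leqNgt; apply/negP => lt_ym; have := wv _ yA lt_ym; lia.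
  have rk_y : rank_in w' y = m.
    rewrite -rk_x; apply: eq_card => z; rewrite !inE.
    by case zA: (z \in A) => //=; apply: wU.
  case: (eqVneq y x) => [yx | neq_yx]; first by rewrite -{2}yx rk_y.
  have lt_xy : v' x < v' y.
    rewrite ltn_neqAle (inj_eq v_inj) eq_sym neq_yx /= leqNgt.
    by rewrite -wU // ltnn.
  have lt_yx : w' y < w' x.
    by rewrite ltn_neqAle (inj_eq w_inj) neq_yx /= leqNgt wU // ltnn.
  case: (ltnP y k) => [lt_yk | le_ky].
    by move: lt_xy; rewrite -(rank_in_lt _ _ xA) (hd _ yA lt_yk) rk_y rk_x ltnn.
  have [i yi] := predE y le_ky; have iA := A_pred yi yA.
  have lt_i : rank_in w' i < m by rewrite -rk_y rank_in_lt ?w_inc.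
  have lt_j : rank_in v' j < m by rewrite -rk_x rank_in_lt ?v_inc.
  move: lt_yx; rewrite (w_sh _ _ _ _ yi xj) -(rank_in_lt _ _ iA).
  rewrite (wv _ iA lt_i) -(vw _ jA lt_j) rank_in_lt // -(v_sh _ _ _ _ yi xj).
  by rewrite ltnNge ltnW.
move=> Pv Pw hd.
have hd' : same_head_rank w v by move=> r rA rk; rewrite hd.
have [vw _] : agree #|A|.+1 v w /\ agree #|A|.+1 w v.
  elim: #|A|.+1 => [|m [vw wv]]; first by split.
  by split; apply: step.
move=> x xA; apply: vw => //; rewrite ltnS; apply/subset_leq_card/subsetP => z.
by rewrite inE => /andP[].
Qed.

End Rank.

(** * Rising and falling residue classes modulo [k] *)

Section Determined.

Variables n k : nat.
Hypotheses (k_gt0 : 0 < k) (lt_2k_n : 2 * k < n).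

Definition head (x : 'I_n) : 'I_n :=
  Ordinal (leq_ltn_trans (leq_mod x k) (ltn_ord x)).

Lemma head_lt (x : 'I_n) : head x < k.
Proof. by rewrite /= ltn_mod. Qed.

Lemma head_id (x : 'I_n) : x < k -> head x = x.
Proof. by move=> lt_xk; apply: val_inj; rewrite /= modn_small. Qed.

Lemma head_shift (x y : 'I_n) : y = x + k :> nat -> head y = head x.
Proof. by move=> yx; apply: val_inj; rewrite /= yx modnDr. Qed.

(** Since [2 * k < n], every residue class has a second position, so its direction is defined. *)
Lemma next_proof (x : 'I_n) : x %% k + k < n.
Proof. by have := ltn_pmod x k_gt0; lia. Qed.

Definition second (x : 'I_n) : 'I_n := Ordinal (next_proof x).

Lemma shift_ind (P : 'I_n -> Prop) :
  (forall x, P (head x)) ->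
  (forall x y : 'I_n, y = x + k :> nat -> P x -> P y) ->
  forall x, P x.
Proof.
move=> P0 PS x; have [m] := ubnP x; elim: m => // m IHm in x *.
rewrite ltnS => le_xm; case: (ltnP x k) => [lt_xk | le_kx].
  by rewrite -(head_id lt_xk).
have lt : x - k < n by have := ltn_ord x; lia.
by apply: (PS (Ordinal lt)) => /=; [lia | apply: IHm => /=; lia].
Qed.

Section OneFunction.

Variable v : 'S_n.
Hypothesis v_sh : shift_invariant k (fun x => v x).

(** The first step of a class decides its direction: shift invariance carries this comparison to all
    later steps. *)
Definition rising (x : 'I_n) := v (head x) < v (second x).

Lemma rising_shift (x y : 'I_n) : y = x + k :> nat -> rising y = rising x.
Proof.
move=> yx; rewrite /rising (head_shift yx).
by congr (_ < v _); apply: val_inj; rewrite /= yx modnDr.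
Qed.

Lemma rising_head (x : 'I_n) : rising (head x) = rising x.
Proof.
rewrite /rising (head_id (head_lt x)).
by congr (_ < v _); apply: val_inj; rewrite /= modn_mod.
Qed.

Lemma rising_lt (x y : 'I_n) : y = x + k :> nat -> (v x < v y) = rising x.
Proof.
elim/shift_ind: x y => [x y yx | x x' xx' IHx y yx'].
  rewrite /rising (head_id (head_lt x)).
  by congr (_ < v _); apply: val_inj; rewrite /= yx modn_mod.
by rewrite (v_sh xx' yx') (IHx _ xx') (rising_shift xx').
Qed.

Lemma falling_lt (x y : 'I_n) : y = x + k :> nat -> (v y < v x) = ~~ rising x.
Proof.
move=> yx; rewrite -(rising_lt yx).
case: ltngtP => // /val_inj/perm_inj eq_xy.
by move: yx; rewrite eq_xy; lia.
Qed.

Lemma rising_ge_head (x : 'I_n) : rising x -> v (head x) <= v x.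
Proof.
elim/shift_ind: x => [x _|x y yx IHx]; first by rewrite (head_id (head_lt x)).
rewrite (rising_shift yx) (head_shift yx) => rx.
by apply: leq_trans (IHx rx) _; rewrite ltnW // rising_lt.
Qed.

Lemma falling_le_head (x : 'I_n) : ~~ rising x -> v x <= v (head x).
Proof.
elim/shift_ind: x => [x _|x y yx IHx]; first by rewrite (head_id (head_lt x)).
rewrite (rising_shift yx) (head_shift yx) => rx.
by apply: leq_trans _ (IHx rx); rewrite ltnW // falling_lt.
Qed.

(** Induction on [x + y]. Two non-heads are shifted back together. If only one position is a head,
    its successor replaces it, which sharpens the inequality, and the new pair shifts back to one of
    smaller sum. *)
Lemma rising_below_falling (x y : 'I_n) : rising x -> ~~ rising y ->
  v (head x) < v (head y) -> v x < v y.
Proof.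
have [m] := ubnP (x + y); elim: m => // m IHm in x y *.
rewrite ltnS => le_m rx ry lt_h.
have predE (z : 'I_n) : k <= z -> {t : 'I_n | z = t + k :> nat}.
  move=> le_kz; have lt : z - k < n by have := ltn_ord z; lia.
  by exists (Ordinal lt); rewrite /= subnK.
have succE (z : 'I_n) : z < k -> {t : 'I_n | t = z + k :> nat}.
  move=> lt_zk; have lt : z + k < n by lia.
  by exists (Ordinal lt).
case: (ltnP x k) => [lt_xk | /predE[x0 xx0]]; last first.
  have rx0 : rising x0 by rewrite -(rising_shift xx0).
  move: lt_h; rewrite (head_shift xx0) => lt_h.
  case: (ltnP y k) => [lt_yk | /predE[y0 yy0]].
    have [y1 y1y] := succE _ lt_yk.
    apply: (@ltn_trans (v y1)); last by rewrite falling_lt.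
    by rewrite (v_sh xx0 y1y) IHm //; lia.
  rewrite (v_sh xx0 yy0) IHm //; first by lia.
    by rewrite -(rising_shift yy0).
  by rewrite -(head_shift yy0).
case: (ltnP y k) => [lt_yk | /predE[y0 yy0]].
  by rewrite -(head_id lt_xk) -(head_id lt_yk).
have [x1 x1x] := succE _ lt_xk.
apply: (@ltn_trans (v x1)); first by rewrite rising_lt.
rewrite (v_sh x1x yy0) IHm //; first by lia.
  by rewrite -(rising_shift yy0).
by rewrite -(head_shift yy0).
Qed.

(** The heads already separate the two classes, as each class moves away from the other. *)
Lemma falling_below_rising (x y : 'I_n) : ~~ rising x -> rising y ->
  v (head x) < v (head y) -> v x < v y.
Proof.
move=> rx ry lt_h; apply: leq_ltn_trans (falling_le_head rx) _.
exact: leq_trans lt_h (rising_ge_head ry).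
Qed.

Lemma mixed_lt (x y : 'I_n) : rising x != rising y ->
  (v x < v y) = (v (head x) < v (head y)).
Proof.
have half (a b : 'I_n) : rising a != rising b ->
    v (head a) < v (head b) -> v a < v b.
  case ra: (rising a); case rb: (rising b) => // _.
    by apply: rising_below_falling; rewrite ?rb.
  by apply: falling_below_rising; rewrite ?ra.
move=> neq_r; apply/idP/idP; last exact: half.
move=> lt_xy; rewrite ltnNge leq_eqVlt; apply/negP => /orP[/eqP|].
  move=> /val_inj/perm_inj eq_h.
  by move: neq_r; rewrite -rising_head -(rising_head y) eq_h eqxx.
by move=> /half; rewrite eq_sym => /(_ neq_r); rewrite ltnNge ltnW.
Qed.

(* If the class of [r] rises, only elements of classes with a smaller head can lie
   below [r]; if it falls, all of those and the later elements of the class do. *)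
Lemma rising_headE (r : 'I_n) : r < k ->
  rising r = (v r <= #|[set y | v (head y) < v r]|).
Proof.
move=> lt_rk; have hr := head_id lt_rk.
case rr: (rising r); apply/esym.
  rewrite -[X in X <= _]card_perm_lt.
  apply/subset_leq_card/subsetP => y; rewrite !inE => lt_yr.
  case ry: (rising y); first by apply: leq_ltn_trans lt_yr; apply: rising_ge_head.
  by rewrite -hr -mixed_lt // rr ry.
apply/negbTE; rewrite -ltnNge -[X in _ < X]card_perm_lt.
apply/proper_card/properP; split.
  apply/subsetP => y; rewrite !inE => lt_yr.
  case ry: (rising y); first by rewrite mixed_lt ?hr // rr ry.
  by apply: leq_ltn_trans lt_yr; apply: falling_le_head; rewrite ry.
(* Strictness: [second r] lies below [r] in value, but its head is [r] itself. *)
have e : second r = r + k :> nat by rewrite /= modn_small.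
exists (second r); rewrite inE; first by rewrite (falling_lt e) rr.
by rewrite (head_shift e) hr ltnn.
Qed.

End OneFunction.

(** * Uniqueness of a shift-invariant permutation with given first [k] entries *)

Section TwoFunctions.

Variables v w : 'S_n.
Hypotheses (v_sh : shift_invariant k (fun x => v x))
  (w_sh : shift_invariant k (fun x => w x))
  (vw : forall r : 'I_n, r < k -> v r = w r).

(** By [rising_headE] the direction of a class depends on the values at heads alone. *)
Lemma rising_unique (x : 'I_n) : rising v x = rising w x.
Proof.
rewrite -rising_head -(rising_head w) !rising_headE ?head_lt //.
rewrite -vw ?head_lt //; congr (_ <= _).
by apply: eq_card => y; rewrite !inE vw ?head_lt.
Qed.

Definition sign_class (b : bool) : {set 'I_n} := [set x | rising v x == b].

(** Reversal counts the elements of [A] above [x] instead of those below. This transfers equality of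
    head ranks to the reversed functions. *)
Lemma rank_rev (A : {set 'I_n}) (u : 'S_n) (x : 'I_n) : x \in A ->
  rank_in A (fun y => n - u y) x = #|A| - (rank_in A (fun y => u y) x).+1.
Proof.
move=> xA; pose B := [set z in A | u z < u x]; pose C := [set z in A | u x < u z].
have -> : rank_in A (fun y => n - u y) x = #|C|.
  apply: eq_card => z; rewrite !inE; congr (_ && _).
  by have := ltn_ord (u z); have := ltn_ord (u x); lia.
have defA : A = x |: (B :|: C).
  apply/setP => z; rewrite !inE; case: (eqVneq z x) => [-> // | neq_zx] /=.
  case: (z \in A) => //=; case: ltngtP => // /val_inj/perm_inj eq_zx.
  by rewrite eq_zx eqxx in neq_zx.
have disjBC : B :&: C = set0.
  by apply/setP => z; rewrite !inE; case: (z \in A) => //=; case: ltngtP.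
have notx : x \notin B :|: C by rewrite !inE ltnn !andbF.
have -> : rank_in A (fun y => u y) x = #|B| by [].
by rewrite [in RHS]defA cardsU1 notx cardsU disjBC cards0; lia.
Qed.

Lemma sign_class_pred (b : bool) (x y : 'I_n) :
  y = x + k :> nat -> y \in sign_class b -> x \in sign_class b.
Proof. by move=> yx; rewrite !inE (rising_shift v yx). Qed.

Lemma mixed_lt_unique (x y : 'I_n) : rising v x != rising v y ->
  (v x < v y) = (w x < w y).
Proof.
move=> neq_r; rewrite (mixed_lt v_sh) // !vw ?head_lt // -(mixed_lt w_sh) //.
by rewrite -!rising_unique.
Qed.

(* The rank of a head among all positions is its value; the positions of the
   opposite sign contribute equally to both sides. *)
Lemma head_rank_unique (b : bool) :
  same_head_rank k (sign_class b) (fun x => v x) (fun x => w x).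
Proof.
move=> r; rewrite inE => /eqP rb lt_rk.
have split_rank (u : 'S_n) : u r =
    rank_in (sign_class b) (fun x => u x) r
    + rank_in (~: sign_class b) (fun x => u x) r :> nat.
  rewrite -[LHS]card_perm_lt -(cardsID (sign_class b)).
  by congr (_ + _); apply: eq_card => z; rewrite !inE // andbC.
apply: (@addIn (rank_in (~: sign_class b) (fun x => v x) r)).
rewrite -split_rank vw // split_rank; congr (_ + _).
apply: eq_card => z; rewrite !inE; case: eqVneq => //= neq_z.
by rewrite mixed_lt_unique // rb.
Qed.

(** [rank_in_unique] applies directly to the rising positions, and to the falling ones after
    reversal. *)
Lemma same_sign_lt_unique (b : bool) :
  {in sign_class b &, forall x y, (v x < v y) = (w x < w y)}.
Proof.
move=> x y xA yA; have hd := head_rank_unique (b := b).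
have pred := @sign_class_pred b.
have nat_inj (u : 'S_n) : injective (fun x => u x : nat).
  by move=> i j /val_inj/perm_inj.
case: b xA yA hd pred => xA yA hd pred.
  have rk : {in sign_class true, rank_in (sign_class true) (fun x => v x)
                               =1 rank_in (sign_class true) (fun x => w x)}.
    apply: (rank_in_unique pred _ _ hd); split=> //.
      move=> i j ji /(pred _ _ ji); rewrite inE => /eqP ri.
      by rewrite (rising_lt v_sh).
    move=> i j ji /(pred _ _ ji); rewrite inE rising_unique => /eqP ri.
    by rewrite (rising_lt w_sh).
  rewrite -(rank_in_lt (fun x => v x) y xA) -(rank_in_lt (fun x => w x) y xA).
  by rewrite !rk.
pose rev (u : 'S_n) (x : 'I_n) := n - u x.
have rev_lt (u : 'S_n) i j : (rev u i < rev u j) = (u j < u i).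
  by rewrite /rev; have := ltn_ord (u i); have := ltn_ord (u j); lia.
have rev_inj (u : 'S_n) : injective (rev u).
  move=> i j eq_ij; apply: (nat_inj u) => /=; move: eq_ij.
  by rewrite /rev; have := ltn_ord (u i); have := ltn_ord (u j); lia.
have rev_sh (u : 'S_n) : shift_invariant k (fun x => u x) ->
    shift_invariant k (rev u).
  by move=> u_sh i j i' j' ei ej; rewrite !rev_lt; apply: u_sh.
have rk : {in sign_class false, rank_in (sign_class false) (rev v)
                              =1 rank_in (sign_class false) (rev w)}.
  apply: (rank_in_unique pred).
  - split; [exact: rev_inj| |exact: rev_sh].
    move=> i j ji /(pred _ _ ji); rewrite inE rev_lt => /eqP ri.
    by rewrite (falling_lt v_sh) ?ri.
  - split; [exact: rev_inj| |exact: rev_sh].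
    move=> i j ji /(pred _ _ ji); rewrite inE rev_lt rising_unique => /eqP ri.
    by rewrite (falling_lt w_sh) ?ri.
  by move=> r rA lt_rk; rewrite !rank_rev // hd.
by rewrite -!rev_lt -(rank_in_lt _ _ yA) -[RHS](rank_in_lt _ _ yA) !rk.
Qed.

Lemma shift_invariant_unique : v = w.
Proof.
apply: perm_lt_inj => x y.
case: (eqVneq (rising v x) (rising v y)) => [eq_r|]; last exact: mixed_lt_unique.
by apply: (same_sign_lt_unique (b := rising v x)); rewrite inE ?eq_r.
Qed.

End TwoFunctions.
End Determined.

(** * Counting, and comparison with the stated bound *)

Lemma num_closed_walk_vertices_le (n k : nat) : 0 < k -> 2 * k < n ->
  num_closed_walk_vertices n k <= n ^_ k.
Proof.
move=> k_gt0 lt_2k_n; have le_kn : k <= n by lia.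
pose f (v : 'S_n) := [ffun i : 'I_k => v (widen_ord le_kn i)].
rewrite /num_closed_walk_vertices; set W := [set v | _].
have W_sh v : v \in W -> shift_invariant k (fun x => v x).
  by rewrite inE => /existsP[p /andP[]]; apply: closed_walk_shift_invariant.
(* Restriction to the first [k] entries embeds [W] into the injective maps from ['I_k] to ['I_n],
   which number [n ^_ k]. *)
have f_inj : {in W &, injective f}.
  move=> v w /W_sh v_sh /W_sh w_sh /ffunP eq_f.
  apply: (shift_invariant_unique k_gt0 lt_2k_n) => // r lt_rk.
  have := eq_f (Ordinal lt_rk); rewrite !ffunE.
  by have -> : widen_ord le_kn (Ordinal lt_rk) = r by apply: val_inj.
rewrite -(card_in_imset f_inj) -[X in X ^_ _]card_ord -[X in _ ^_ X]card_ord.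
rewrite -card_inj_ffuns -[X in _ <= X]cardsE; apply/subset_leq_card/subsetP => g.
case/imsetP => v _ ->; rewrite !inE; apply/injectiveP => i j.
by rewrite !ffunE => /perm_inj[] /val_inj.
Qed.

Local Open Scope ring_scope.

Theorem theorem5p2 (n k : nat) (hk3 : (3 <= k)%N) (hkn : (k <= n - 1)%N)
    (hn2k : (n > 2 * k)%N) (hodd : odd n) :
  ((num_closed_walk_vertices n k)%:R : rat) <=
    ((n - 2)`!)%:R / ((n - k)`!)%:R *
    ((n%:R + 1 / 2) * (n%:R + 1) * (n%:R - 1) + k%:R + (n%:R - 5) / 2 - 2
     - (n%:R - 1) * (Num.ceil ((n%:R - 1) / 4 : rat))%:~R).
Proof.
have ffactE : (n ^_ k)%:R = ((n - 2)`!)%:R / ((n - k)`!)%:R * (n%:R * (n%:R - 1)) :> rat.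
  have fact_neq0 : ((n - k)`!)%:R != 0 :> rat by rewrite pnatr_eq0 -lt0n fact_gt0.
  apply: (mulIf fact_neq0); rewrite -natrM ffact_fact; last by lia.
  rewrite mulrAC divfK //.
  have [m ->] : exists m, n = m.+2 by exists (n - 2)%N; lia.
  by rewrite !factS subn2 /= !natrM -!natr1; ring.
apply: (@le_trans _ _ ((n ^_ k)%:R : rat)).
  by rewrite ler_nat num_closed_walk_vertices_le //; lia.
rewrite ffactE ler_wpM2l ?divr_ge0 ?ler0n //.
set c := _%:~R.
(* The ceiling enters with a negative sign, so an upper estimate suffices; a quadratic [n * (n - 1)]
   is then compared with a cubic for [n >= 7]. *)
have ceil_lt : c < (n%:R - 1) / 4 + 1 :> rat.
  by rewrite -ltrBlDr; have := ceil_itv ((n%:R - 1) / 4 : rat); lra.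
have n7 : 7 <= n%:R :> rat by rewrite (ler_nat _ 7); lia.
have k3 : 3 <= k%:R :> rat by rewrite (ler_nat _ 3).
nra.
Qed.
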